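(* Let $E$ be an $n$-dimensional vector space over a field $\mathbb{F}$ and let $\tilde{\mathcal{I}}\subseteq\mathcal{L}(E)$ be a collection of subspaces satisfying the axioms (I1), (I2) and (nI3). Then $(E,\tilde{\mathcal{I}})$ is a $q$-matroid, i.e. $\tilde{\mathcal{I}}$ satisfies (I1), (I2), (I3) and (I4).
   Context: $n$ is a positive integer, $\mathbb{F}$ is an arbitrary field, and $\mathcal{L}(E)$ denotes the lattice of all subspaces of $E$; for a subspace $A$, $\mathcal{L}(A)$ is the set of all subspaces of $A$. For a family $\mathcal{A}\subseteq\mathcal{L}(E)$, $\max(\mathcal{A})$ is the set of members of $\mathcal{A}$ that are maximal with respect to inclusion. Axioms for $\mathcal{I}\subseteq\mathcal{L}(E)$: (I1) $\mathcal{I}\neq\emptyset$. (I2) For all $I,J\in\mathcal{L}(E)$, if $J\in\mathcal{I}$ and $I\subseteq J$, then $I\in\mathcal{I}$. (I3) For all $I,J\in\mathcal{I}$ with $\dim I<\dim J$, there exists a $1$-dimensional subspace $x\subseteq J$, $x\not\subseteq I$, such that $I+x\in\mathcal{I}$. (I4) For all $A,B\in\mathcal{L}(E)$ and $I,J\in\mathcal{L}(E)$ such that $I\in\max(\mathcal{I}\cap\mathcal{L}(A))$ and $J\in\max(\mathcal{I}\cap\mathcal{L}(B))$, there exists $K\in\max(\mathcal{I}\cap\mathcal{L}(A+B))$ such that $K\subseteq I+J$. (nI3) For all $I,J\in\mathcal{I}$ satisfying $\dim I<\dim J$, there exists a codimension $1$ subspace $X\subseteq E$ with $I\subseteq X$,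 $J\not\subseteq X$ such that $I+x\in\mathcal{I}$ for all $1$-dimensional $x\subseteq E$, $x\not\subseteq X$. A $q$-matroid given by a family $\mathcal{I}$ of independent spaces is a pair $(E,\mathcal{I})$ such that $\mathcal{I}$ satisfies (I1)-(I4). *)

(* Defs.v *)
From mathcomp Require Import all_boot all_order all_algebra.

Set Implicit Arguments.
Unset Strict Implicit.
Unset Printing Implicit Defensive.

(* The field may be infinite, so {vspace E} need not be finite and membership in
   a family of subspaces need not be decidable: families are Prop-valued. *)
Definition subspace_family (F : fieldType) (E : vectType F) : Type := {vspace E} -> Prop.

Section QMatroidAxioms.

Variables (F : fieldType) (E : vectType F).
Implicit Types (A B I J K X x : {vspace E}).

Definition max_members (P : subspace_family E) : subspace_family E :=
  fun I => P I /\ forall J, P J -> (I <= J)%VS -> J = I.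

(* The intersection of P with the lattice of subspaces of A. *)
Definition restr_members (P : subspace_family E) (A : {vspace E}) : subspace_family E :=
  fun I => P I /\ (I <= A)%VS.

Variable Ind : subspace_family E.

Definition axiom_I1 : Prop := exists I, Ind I.

Definition axiom_I2 : Prop := forall I J, Ind J -> (I <= J)%VS -> Ind I.

Definition axiom_I3 : Prop :=
  forall I J, Ind I -> Ind J -> \dim I < \dim J ->
  exists x, [/\ \dim x = 1, (x <= J)%VS, ~~ (x <= I)%VS & Ind (I + x)%VS].

Definition axiom_I4 : Prop :=
  forall A B I J,
    max_members (restr_members Ind A) I ->
    max_members (restr_members Ind B) J ->
  exists K, max_members (restr_members Ind (A + B)%VS) K /\ (K <= I + J)%VS.

Definition axiom_nI3 : Prop :=
  forall I J, Ind I -> Ind J -> \dim I < \dim J ->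
  exists X, [/\ (\dim X).+1 = \dim {:E}, (I <= X)%VS, ~~ (J <= X)%VS
    & forall x, \dim x = 1 -> ~~ (x <= X)%VS -> Ind (I + x)%VS].

Definition is_qmatroid : Prop :=
  [/\ axiom_I1, axiom_I2, axiom_I3 & axiom_I4].

End QMatroidAxioms.

(* Main.v *)
Require Import Defs.
From mathcomp Require Import all_boot all_order all_algebra.
From Stdlib Require Import Classical.

Set Implicit Arguments.
Unset Strict Implicit.
Unset Printing Implicit Defensive.

(** Call a maximal independent subspace of [A] a basis of [A].

    (I3) follows at once from (nI3): if [J] is not contained in the hyperplane
    [X], a line of [J] outside [X] is also outside [I], and can be added to [I].

    For (I4), let [I] and [J] be bases of [A] and [B], and let [K] be a basis of
    [S := I + J]; we show that [K] is a basis of [A + B].  Otherwise [K] lies in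
    a strictly larger independent [L <= A + B], and (nI3) gives a hyperplane
    [X >= K], not containing [L], such that every line outside [X] can be added
    to [K].  Since [K] is a basis of [S], no line of [S] can be added to it, so
    [S <= X].  On the other hand [L <= A + B], so [A] or [B] has a line [y]
    outside [X], hence outside [S].

    The crux is that [y] can then be added to every independent subspace [M] of
    [S], not only to the basis [K] ([indep_add_line]).  Taking [M := I] when
    [y <= A] and [M := J] when [y <= B] contradicts the maximality of [M].
    Here the strength of (nI3) over (I3) is used a second time: (I3) would only
    add to [M] some line of [K + y], whereas the hyperplane of (nI3) contains
    [S], and therefore misses the line [y] itself. *)

(** The family is an arbitrary predicate, so this needs excluded middle to
    decide whether a given independent space is already maximal. *)
Lemma max_members_extend (F : fieldType) (E : vectType F)
    (P : subspace_family E) (I : {vspace E}) :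
  P I -> exists K, max_members P K /\ (I <= K)%VS.
Proof.
have [k] := ubnP (\dim {:E} - \dim I); elim: k => // k IHk in I * => le_k PI.
case: (classic (max_members P I)) => [maxI | notmaxI]; first by exists I.
have [J [PJ sIJ neqJI]] : exists J, [/\ P J, (I <= J)%VS & J <> I].
  apply: NNPP => noJ; apply: notmaxI; split=> // J PJ sIJ.
  by apply: NNPP => neqJI; apply: noJ; exists J.
have ltIJ : \dim I < \dim J.
  rewrite ltnNge; apply/negP => leJI; apply: neqJI.
  by apply/esym/eqP; rewrite eqEdim sIJ.
have [|K [maxK sJK]] := IHk J _ PJ; last first.
  by exists K; split=> //; apply: subv_trans sJK.
by apply: leq_trans (le_k : _ <= k); rewrite ltn_sub2l // (leq_trans ltIJ) ?dimvS ?subvf.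
Qed.

Lemma not_subv_line (F : fieldType) (E : vectType F) (U V : {vspace E}) :
  ~~ (U <= V)%VS -> exists x, [/\ \dim x = 1, (x <= U)%VS & ~~ (x <= V)%VS].
Proof.
case/subvPn=> u Uu notVu; exists <[u]>%VS; split; rewrite -?memvE //.
by rewrite dim_vline (_ : u != 0%R) //; apply: contraNneq notVu => ->; rewrite mem0v.
Qed.

Section HyperplaneAugmentation.

Variables (F : fieldType) (E : vectType F) (Ind : subspace_family E).
Implicit Types (A B I J K M S X x y : {vspace E}).

Hypotheses (Ind2 : axiom_I2 Ind) (IndH : axiom_nI3 Ind).

Lemma max_members_no_line A K x :
  max_members (restr_members Ind A) K -> (x <= A)%VS -> ~~ (x <= K)%VS ->
  ~ Ind (K + x)%VS.
Proof.
case=> [[_ sKA] maxK] sxA /negP notKx IndKx; apply: notKx.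
by rewrite -(maxK (K + x)%VS) ?addvSl ?addvSr //; split=> //; rewrite subv_add sKA.
Qed.

(** A hyperplane missing a line of [A] would let that line be added to the
    basis [K] of [A]. *)
Lemma max_members_hyperplane A K X :
  max_members (restr_members Ind A) K -> (K <= X)%VS ->
  (forall x, \dim x = 1 -> ~~ (x <= X)%VS -> Ind (K + x)%VS) -> (A <= X)%VS.
Proof.
move=> maxK sKX addX; apply/negPn/negP => /not_subv_line[x [dimx sxA notXx]].
apply: (max_members_no_line maxK sxA _ (addX x dimx notXx)).
by apply: contra notXx => /subv_trans; apply.
Qed.

Lemma hyperplane_exchange : axiom_I3 Ind.
Proof.
move=> I J IndI IndJ /(IndH IndI IndJ)[X [_ sIX notXJ addX]].
have [x [dimx sxJ notXx]] := not_subv_line notXJ.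
by exists x; split; [| | apply: contra notXx => /subv_trans; apply | apply: addX].
Qed.

Lemma max_members_dim A J K :
  max_members (restr_members Ind A) K -> restr_members Ind A J ->
  \dim J <= \dim K.
Proof.
move=> maxK [IndJ sJA]; have [[IndK _] _] := maxK.
rewrite leqNgt; apply/negP => /(hyperplane_exchange IndK IndJ)[x [_ sxJ notKx]].
exact: max_members_no_line (subv_trans sxJ sJA) notKx.
Qed.

(** Enlarge [M] to a basis [K'] of [S].  It has the dimension of [K], so (nI3)
    applies to [K'] and [K + y]; the resulting hyperplane contains [S], hence
    [K], but not [K + y], so [y] is outside it and can be added to [K']. *)
Lemma indep_add_line S K M y :
  max_members (restr_members Ind S) K -> \dim y = 1 -> ~~ (y <= S)%VS ->
  Ind (K + y)%VS -> restr_members Ind S M -> Ind (M + y)%VS.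
Proof.
move=> maxK dimy notSy IndKy /max_members_extend[K' [maxK' sMK']].
have [[[_ sKS] _] [[IndK' _] _]] := (maxK, maxK').
have ltK'Ky : \dim K' < \dim (K + y)%VS.
  apply: leq_ltn_trans (max_members_dim maxK maxK'.1) _.
  rewrite ltnNge; apply: contra notSy => leKyK.
  have /eqP eqK : (K == K + y)%VS by rewrite eqEdim addvSl.
  by apply: subv_trans sKS; rewrite eqK addvSr.
have [X [_ sK'X notXKy addX]] := IndH IndK' IndKy ltK'Ky.
have sSX : (S <= X)%VS := max_members_hyperplane maxK' sK'X addX.
apply: Ind2 (addX y dimy _) (addvS sMK' (subvv y)).
by apply: contra notXKy => syX; rewrite subv_add syX (subv_trans sKS).
Qed.

Lemma hyperplane_basis_sum : axiom_I4 Ind.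
Proof.
move=> A B I J maxI maxJ.
have [[[IndI sIA] _] [[IndJ sJB] _]] := (maxI, maxJ).
have [|K [maxK _]] := @max_members_extend _ _ (restr_members Ind (I + J)%VS) I.
  by split; rewrite ?addvSl.
have [[IndK sKIJ] _] := maxK; exists K; split=> //.
have [|L [maxL sKL]] := @max_members_extend _ _ (restr_members Ind (A + B)%VS) K.
  by split=> //; apply: subv_trans sKIJ (addvS sIA sJB).
have [leLK | ltKL] := leqP (\dim L) (\dim K).
  by have /eqP -> : (K == L)%VS by rewrite eqEdim sKL.
have [[IndL sLAB] _] := maxL.
have [X [_ sKX notXL addX]] := IndH IndK IndL ltKL.
have sIJX : (I + J <= X)%VS := max_members_hyperplane maxK sKX addX.
(* The situation is symmetric in (A, I) and (B, J). *)
have subX C M : max_members (restr_members Ind C) M -> (M <= I + J)%VS -> (C <= X)%VS.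
  move=> maxM sMIJ; have [[IndM _] _] := maxM.
  apply/negPn/negP => /not_subv_line[y [dimy syC notXy]].
  have notIJy : ~~ (y <= I + J)%VS by apply: contra notXy => /subv_trans; apply.
  apply: (max_members_no_line maxM syC).
    by apply: contra notIJy => /subv_trans; apply.
  exact: indep_add_line maxK dimy notIJy (addX y dimy notXy) (conj IndM sMIJ).
case/negP: notXL; apply: subv_trans sLAB _.
by rewrite subv_add (subX A I maxI) ?addvSl // (subX B J maxJ) ?addvSr.
Qed.

End HyperplaneAugmentation.

Theorem theorem25 (F : fieldType) (n : nat) (E : vectType F)
    (n_gt0 : 0 < n) (dimE : \dim {:E} = n) (Ind : subspace_family E) :
  axiom_I1 Ind -> axiom_I2 Ind -> axiom_nI3 Ind -> is_qmatroid Ind.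
Proof.
move=> Ind1 Ind2 IndH; split=> //.
  exact: hyperplane_exchange.
exact: hyperplane_basis_sum.
Qed.
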